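(* Let $G$ be a group and let $A$ be a finite-dimensional vector space over a field $K$. Let $\Sigma \subset A^G$ be a linear subshift and let $\tau \colon A^G \to A^G$ be a linear cellular automaton. Then $\tau(\Sigma)$ is a linear subshift of $A^G$.
   Context: $A^G$ is the $K$-vector space of all maps $x \colon G \to A$, equipped with the prodiscrete topology (product topology with each factor $A$ discrete) and with the shift action $(gx)(h) = x(g^{-1}h)$. A linear subshift of $A^G$ is a closed $G$-invariant vector subspace of $A^G$. A linear cellular automaton $\tau \colon A^G \to A^G$ is a map for which there exist a finite subset $M \subset G$ and a $K$-linear map $\mu \colon A^M \to A$ with $\tau(x)(g) = \mu((g^{-1}x)|_M)$ for all $x \in A^G$, $g \in G$. The group $G$ is arbitrary (not assumed countable). *)

(* Defs.v *)
From HB Require Import structures.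
From mathcomp Require Import all_boot all_algebra finmap.
From mathcomp Require Import all_classical topology function_spaces.

Set Implicit Arguments.
Unset Strict Implicit.
Unset Printing Implicit Defensive.

Import GRing.Theory.
Local Open Scope classical_set_scope.
Local Open Scope ring_scope.

Section LinearSubshifts.
Variables (G : groupType) (K : fieldType) (A : vectType K).
Implicit Types (x : G -> A) (S : set (G -> A)) (tau : (G -> A) -> (G -> A)).

Definition shift_act (g : G) x : G -> A := fun h => x (g^-1 * h)%g.

(* The cast selects the product topology on [G -> A] in which every factor [A]
   is discrete. *)
Definition prodiscrete_closed S : Prop :=
  closed (S : set {ptws G -> discrete_topology A}).

Definition shift_invariant S : Prop :=
  forall (g : G) x, S x -> S (shift_act g x).

Definition linear_subshift S : Prop :=
  [/\ prodiscrete_closed S, shift_invariant S & submod_closed [in S]].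

Definition restrict_fset (M : {fset G}) x : {ffun M -> A} :=
  [ffun m => x (val m)].

Definition linear_cellular_automaton tau : Prop :=
  exists (M : {fset G}) (mu : {linear {ffun M -> A} -> A}),
    forall x (g : G), tau x g = mu (restrict_fset M (shift_act g^-1%g x)).

End LinearSubshifts.

(* Main.v *)
(** The fibres [{x in Sigma | tau x = y on F}], for [F] finite, are affine
    subspaces, directed by inclusion, and nonempty when [y] lies in the closure
    of [tau Sigma].  A point common to all of them is built coordinate by
    coordinate: by Zorn's lemma there is a maximal set of prescribed values
    [x g = a] which is finitely compatible with every fibre.  It prescribes a
    value at every [g], because the values at [g] allowed by finitely many
    prescriptions and one fibre form a directed family of nonempty affine
    subspaces of [A], whose intersection is nonempty as [A] is
    finite-dimensional. *)

Require Import Defs.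
From mathcomp Require Import all_boot all_algebra all_classical.
From mathcomp Require Import finmap topology function_spaces.

Set Implicit Arguments.
Unset Strict Implicit.
Unset Printing Implicit Defensive.

Import GRing.Theory.
Local Open Scope classical_set_scope.
Local Open Scope ring_scope.

(** Three points are used because over the field with two elements every set contains the lines
    through its pairs of points. The empty set qualifies. *)
Definition affine_set (K : fieldType) (V : lmodType K) (P : set V) :=
  forall (k : K) x y z, P x -> P y -> P z -> P (x + k *: (y - z)).

Lemma affine_combE (K : fieldType) (V : lmodType K) (k : K) (x y z : V) :
  x + k *: (y - z) = k *: y + (- k *: z + x).
Proof. by rewrite scalerBr scaleNr [RHS]addrA [RHS]addrC. Qed.

Lemma submod_closed_affine (K : fieldType) (V : lmodType K) (S : set V) :
  submod_closed [in S] -> affine_set S.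
Proof.
move=> [_ linS] k x y z /mem_set Sx /mem_set Sy /mem_set Sz.
rewrite affine_combE.
by apply/set_mem/linS => //; apply: linS.
Qed.

(** Take [U] of maximal dimension with [v + U] inside [P]. For [x] in [P], adjoining [x - v] to [U]
    keeps the translate inside [P], so maximality puts [x - v] in [U]. *)
Lemma affine_set_vspace (K : fieldType) (A : vectType K) (P : set A) (v : A) :
  affine_set P -> P v -> exists U : {vspace A}, P = [set x | x - v \in U].
Proof.
move=> affP Pv.
pose Q n := `[< exists2 U : {vspace A}, \dim U = n &
                  forall u, u \in U -> P (v + u) >].
have exQ : exists n, Q n.
  exists 0%N; apply/asboolP; exists 0%VS; first exact: dimv0.
  by move=> u; rewrite memv0 => /eqP ->; rewrite addr0.
have ubQ n : Q n -> (n <= \dim {:A})%N.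
  by move=> /asboolP[U <- _]; exact: dimvS (subvf U).
case: (ex_maxnP exQ ubQ) => n /asboolP[U dimU UP] maxU.
exists U; apply/seteqP; split => x /= => [Px|/UP]; last by rewrite addrC subrK.
have UxP u : u \in (U + <[x - v]>)%VS -> P (v + u).
  case/memv_addP => u1 Uu1 [_ /vlineP[k ->] ->].
  by rewrite addrA; apply: affP => //; exact: UP.
have : (\dim (U + <[x - v]>) <= \dim U)%N.
  by rewrite dimU; apply: maxU; apply/asboolP; exists (U + <[x - v]>)%VS.
move=> le_dim; have /eqP -> : U == (U + <[x - v]>)%VS by rewrite eqEdim addvSl.
by apply: (subvP (addvSr _ _)); exact: memv_line.
Qed.

(** A member [P i] whose direction has least dimension lies in every [P j]: a [P k] inside both has
    the same direction as [P i], hence equals it. *)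
Lemma directed_affine_bigcap (K : fieldType) (A : vectType K) (I : Type)
    (i0 : I) (P : I -> set A) :
  (forall i, affine_set (P i)) -> (forall i, P i !=set0) ->
  (forall i j, exists k, P k `<=` P i `&` P j) ->
  exists a, forall i, P i a.
Proof.
move=> affP /choice[v Pv] dirP.
have /choice[U PU] i : exists U : {vspace A}, P i = [set x | x - v i \in U].
  exact: affine_set_vspace.
have exn : exists n, `[< exists i, \dim (U i) = n >].
  by exists (\dim (U i0)); apply/asboolP; exists i0.
case: (ex_minnP exn) => n /asboolP[i dimUi] minU; exists (v i) => j.
have [k Pk] := dirP i j.
have vkE : v k - v i \in U i by have := (Pk _ (Pv k)).1; rewrite PU.
have UkE : U k = U i.
  apply/eqP; rewrite eqEdim dimUi minU ?andbT; last by apply/asboolP; exists k.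
  apply/subvP => u Uu; have : P k (v k + u) by rewrite PU /= addrAC subrr add0r.
  move=> /Pk[+ _]; rewrite PU /= => Uku.
  by have := memvB Uku vkE; rewrite opprB addrA subrK addrAC subrr add0r.
by apply: (Pk _ _).2; rewrite PU /= UkE -opprB memvN.
Qed.

Lemma chain_bigcup_seq (T : eqType) (F : set (set T)) (s : seq T) :
  F !=set0 -> total_on F subset ->
  {in s, forall p, (\bigcup_(X in F) X) p} ->
  exists2 X, F X & {in s, forall p, X p}.
Proof.
move=> [X0 FX0] totF; elim: s => [|p s IHs] sF; first by exists X0.
have [q sq|X FX sX] := IHs; first by apply: sF; rewrite inE sq orbT.
have [Y FY Yp] := sF p (mem_head p s).
have [XY|YX] := totF _ _ FX FY.
  by exists Y => // q; rewrite inE => /predU1P[->//|/sX]; exact: XY.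
by exists X => // q; rewrite inE => /predU1P[->|/sX//]; exact: YX.
Qed.

(** The point found lies in the prodiscrete closure of every [L i]; membership then follows wherever
    closedness is known. *)
Lemma directed_affine_adherent (T : choiceType) (K : fieldType)
    (A : vectType K) (I : Type) (i0 : I) (L : I -> set (T -> A)) :
  (forall i, affine_set (L i)) -> (forall i, L i !=set0) ->
  (forall i j, exists k, L k `<=` L i `&` L j) ->
  exists x, forall i (E : seq T), exists2 z, L i z & {in E, z =1 x}.
Proof.
move=> affL L0 dirL.
pose meets (s : seq (T * A)) i :=
  [set z | L i z /\ {in s, forall p, z p.1 = p.2}].
pose Q := [set S : set (T * A) | forall s, {in s, forall p, S p} ->
  forall i, meets s i !=set0].
have [|S [QS maxS]] := @Zorn_bigcup _ Q.
  move=> F FQ totF s sF i; have [F0|/set0P F0] := eqVneq F set0.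
    (* The empty chain has empty union, so only the empty list of prescriptions occurs. *)
    case: s sF => [|p s] sF; first by have [z Lz] := L0 i; exists z.
    by have [X] := sF p (mem_head p s); rewrite F0.
  by have [X /FQ QX sX] := chain_bigcup_seq F0 totF sF; exact: QX.
have Stot g : exists a, S (g, a).
  pose inS (s : seq (T * A)) := {in s, forall p, S p}.
  have nilS : inS [::] by [].
  have [||[[s1 S1] i1] [[s2 S2] i2]|a Pa] := @directed_affine_bigcap K A
      ({s | inS s} * I)%type (exist inS _ nilS, i0)
      (fun si => [set z g | z in meets (sval si.1) si.2]).
  - move=> [[s sS] i] k _ _ _ [x [Lx xs] <-] [y [Ly ys] <-] [z [Lz zs] <-] /=.
    exists (x + k *: (y - z)) => //; split; first exact: affL.
    move=> p sp; transitivity (x p.1 + k *: (y p.1 - z p.1)) => //.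
    by rewrite xs // ys // zs // subrr scaler0 addr0.
  - by move=> [[s sS] i] /=; have [z mz] := QS s sS i; exists (z g); exists z.
  - have S12 : inS (s1 ++ s2).
      by move=> p; rewrite mem_cat => /orP[/S1|/S2].
    have [k Lk] := dirL i1 i2; exists (exist inS _ S12, k).
    move=> _ [z [/Lk[L1z L2z] zs] <-] /=; split; exists z => //; split=> // p sp;
      by apply: zs; rewrite mem_cat sp ?orbT.
  exists a; apply: contrapT => nSa.
  (* Adding [(g, a)] keeps [S] in [Q]: for a list [s], drop [(g, a)] to get [s'] in [S]; by choice
     of [a], some [z] meets [s'] with [z g = a]. *)
  apply: (maxS (S `|` [set (g, a)])).
    by split=> [p Sp|/(_ (g, a))]; [left | move=> /(_ (or_intror erefl))].
  move=> s sS i; pose s' := [seq p <- s | p != (g, a)].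
  have s'S : inS s'.
    move=> p; rewrite mem_filter => /andP[pga /sS[//|/= pE]].
    by rewrite pE eqxx in pga.
  have [z [Lz zs] zg] := Pa (exist inS s' s'S, i).
  exists z; split=> // p sp; have [->//|pga] := eqVneq p (g, a).
  by apply: zs; rewrite mem_filter pga.
have [x Sx] := choice Stot; exists x => i E.
have [|z [Lz zE]] := QS [seq (g, x g) | g <- E] _ i; first by move=> _ /mapP[g _ ->].
by exists z => // g Eg; apply: (zE (g, x g)); apply: map_f.
Qed.

Section ProdiscreteTopology.
Variables (G : groupType) (K : fieldType) (A : vectType K).
Implicit Type S : set (G -> A).

Lemma nbhs_prodiscreteP (x : G -> A) (B : set (G -> A)) :
  nbhs (x : {ptws G -> discrete_topology A}) B <->
  exists E : seq G, forall z, {in E, z =1 x} -> B z.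
Proof.
split=> [xB|[E EB]].
  pose F : set_system (G -> A) :=
    filter_from [set: seq G] (fun E => [set z : G -> A | {in E, z =1 x}]).
  have FF : Filter F.
    apply: filter_from_filter; first by exists [::].
    move=> E1 E2 _ _; exists (E1 ++ E2) => // z zE.
    by split=> g Eg; apply: zE; rewrite mem_cat Eg ?orbT.
  suff : F --> (x : {ptws G -> discrete_topology A}).
    by move=> /(_ _ xB)[E _ EB]; exists E.
  (* The product topology is a supremum over coordinates, so one coordinate [g] is treated at a
     time. *)
  apply/cvg_sup => g U [V] [[W] oW <-] Wx WU.
  exists [:: g] => // z zx; apply: WU => /=.
  by rewrite (zx g) ?mem_head.
have xF : Filter (nbhs (x : {ptws G -> discrete_topology A})).
  exact: nbhs_filter.
have xE : nbhs (x : {ptws G -> discrete_topology A}) [set z : G -> A | {in E, z =1 x}].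
  elim: E {EB} => [|g E IHE]; first by apply: filterE.
  have xg : nbhs (x : {ptws G -> discrete_topology A}) [set z : G -> A | z g = x g].
    exact: (@proj_continuous G (fun=> discrete_topology A) g x [set x g]
      (discrete_set1 _)).
  apply: filterS (filterI xg IHE) => z [zg zE] h.
  by rewrite inE => /predU1P[->|/zE].
by apply: filterS xE.
Qed.

Lemma prodiscrete_closedP S :
  prodiscrete_closed S <->
  forall x, (forall E : seq G, exists2 z, S z & {in E, z =1 x}) -> S x.
Proof.
split=> [clS x Sx|SP x clx].
  apply: clS => B /nbhs_prodiscreteP[E EB].
  by have [z Sz zE] := Sx E; exists z; split=> //; exact: EB.
apply: SP => E.
have [|z [Sz zE]] := clx [set z : G -> A | {in E, z =1 x}].
  by apply/nbhs_prodiscreteP; exists E.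
by exists z.
Qed.

End ProdiscreteTopology.

Section LinearCellularAutomata.
Variables (G : groupType) (K : fieldType) (A : vectType K).
Variable tau : (G -> A) -> (G -> A).
Hypothesis tau_lca : linear_cellular_automaton tau.

Lemma lca_shift g x : tau (shift_act g x) = shift_act g (tau x).
Proof.
have [M [mu tauE]] := tau_lca; apply/funext => h.
rewrite /shift_act !tauE; congr (mu _); apply/ffunP => m.
by rewrite !ffunE /shift_act !invgK !mulgA.
Qed.

Lemma lca_linear (k : K) x y : tau (k *: x + y) = k *: tau x + tau y.
Proof.
have [M [mu tauE]] := tau_lca; apply/funext => h.
transitivity (k *: tau x h + tau y h) => //.
rewrite !tauE -linearP; congr (mu _); apply/ffunP => m.
by rewrite !ffunE.
Qed.

Lemma lca_local g : exists E : seq G,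
  forall x y, {in E, x =1 y} -> tau x g = tau y g.
Proof.
(* Since [shift_act g^-1 x] takes the value [x (g * m)] at [m], the window at [g] is the translate
   of [M] by [g]. *)
have [M [mu tauE]] := tau_lca; exists [seq (g * m)%g | m <- enum_fset M].
move=> x y xy; rewrite !tauE; congr (mu _); apply/ffunP => m.
by rewrite !ffunE /shift_act invgK; apply: xy; apply: map_f; exact: valP.
Qed.

Lemma lca_image_closed (Sigma : set (G -> A)) :
  prodiscrete_closed Sigma -> affine_set Sigma ->
  prodiscrete_closed (tau @` Sigma).
Proof.
move=> /prodiscrete_closedP clS affS; apply/prodiscrete_closedP => y yS.
pose L (F : seq G) := [set x | Sigma x /\ {in F, tau x =1 y}].
have [|F|F1 F2|x Lx] := directed_affine_adherent [::] (L := L).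
- move=> F k u v w [Su uF] [Sv vF] [Sw wF]; split; first exact: affS.
  move=> g Fg; rewrite affine_combE !lca_linear.
  transitivity (k *: tau v g + (- k *: tau w g + tau u g)) => //.
  by rewrite uF // vF // wF // scaleNr addrA subrr add0r.
- by have [_ [x Sx <-] xF] := yS F; exists x.
- exists (F1 ++ F2) => x [Sx xF].
  by split; split=> // g Fg; apply: xF; rewrite mem_cat Fg ?orbT.
(* [L [::]] imposes no condition on [tau x], so [x] is adherent to [Sigma] itself. *)
exists x; first by apply: clS => E; have [z [Sz _] zE] := Lx [::] E; exists z.
apply/funext => g; have [E tauE] := lca_local g.
(* [z] satisfies [tau z g = y g] and agrees with [x] on the window [E] at [g], so
   [tau x g = y g]. *)
have [z [_ zy] zx] := Lx [:: g] E.
by rewrite -(tauE _ _ zx) zy ?mem_head.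
Qed.

End LinearCellularAutomata.

Theorem theorem4p1 (G : groupType) (K : fieldType) (A : vectType K)
    (Sigma : set (G -> A)) (tau : (G -> A) -> (G -> A)) :
  linear_subshift Sigma -> linear_cellular_automaton tau ->
  linear_subshift (tau @` Sigma).
Proof.
move=> [clS shS linS] lca; split.
- exact: lca_image_closed (submod_closed_affine linS).
- move=> g _ [x Sx <-]; exists (shift_act g x); first exact: shS.
  exact: lca_shift.
have [S0 SP] := linS; split.
  apply/mem_set; exists 0; first exact: set_mem.
  (* This instance of linearity reads [tau 0 = - tau 0 + tau 0]. *)
  have := lca_linear lca (-1) 0 0.
  by rewrite scaleN1r oppr0 addr0 scaleN1r addNr.
move=> k _ _ /set_mem[x Sx <-] /set_mem[y Sy <-]; apply/mem_set.
exists (k *: x + y); last exact: lca_linear.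
by apply: set_mem; apply: SP; apply: mem_set.
Qed.
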